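(* Let $H$ be an abelian group (a $\mathbb{Z}$-module, not necessarily finitely generated) with an alternating $\mathbb{Z}$-bilinear form $\langle -,-\rangle : H\times H\to\mathbb{Z}$, and suppose $\langle -,-\rangle \neq 0$. Then there are $\mathbb{Q}$-linear isomorphisms \[ H_2(\mathbb{Q}[H]^{(1)})\cong \bigoplus_{z\in\ker\mu}\mathbb{Q}\otimes_{\mathbb{Z}}(H/\mathbb{Z}z) \quad\text{and}\quad H_2(\mathbb{Q}[H])\cong \Big(\textstyle\bigwedge^2_{\mathbb{Q}}\mathbb{Q}[\ker\mu]\Big)\oplus H_2(\mathbb{Q}[H]^{(1)}). \]
   Context: Define $\mu:H\to\mathrm{Hom}_{\mathbb{Z}}(H,\mathbb{Z})$ by $\mu(x)(y)=\langle x,y\rangle$. For a subset $S\subset H$, $\mathbb{Q}[S]$ denotes the $\mathbb{Q}$-vector space with basis the formal symbols $[x]$, $x\in S$ (so $c[x]\neq[cx]$ in general). The homological Goldman Lie algebra is $\mathbb{Q}[H]$ with the bracket $[[x],[y]]=\langle x,y\rangle[x+y]$ extended bilinearly; it is a Lie algebra. Its derived subalgebra $\mathbb{Q}[H]^{(1)}=[\mathbb{Q}[H],\mathbb{Q}[H]]$ equals $\mathbb{Q}[H\setminus\ker\mu]$, and its center is $\mathbb{Q}[\ker\mu]$, so $\mathbb{Q}[H]=\mathbb{Q}[\ker\mu]\oplus\mathbb{Q}[H\setminus\ker\mu]$. $\bigwedge^2_{\mathbb{Q}}\mathbb{Q}[\ker\mu]$ is the exterior square of the vector space $\mathbb{Q}[\ker\mu]$.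 For a Lie algebra $\mathfrak g$ over $\mathbb{Q}$, $H_*(\mathfrak g)$ is Lie algebra homology with trivial coefficients $\mathbb{Q}$, computed by the Chevalley–Eilenberg complex $C_p(\mathfrak g)=\bigwedge^p_{\mathbb{Q}}\mathfrak g$ with $\partial(x_1\wedge\cdots\wedge x_p)=\sum_{i<j}(-1)^{i+j}[x_i,x_j]\wedge x_1\wedge\cdots\widehat{x_i}\cdots\widehat{x_j}\cdots\wedge x_p$. *)

(* Defs.v *)
From HB Require Import structures.
From mathcomp Require Import all_boot all_order all_algebra.
From mathcomp Require Import finmap.
From mathcomp Require Import monalg.
Set Implicit Arguments. Unset Strict Implicit. Unset Printing Implicit Defensive.
Import Order.TTheory GRing.Theory Num.Theory.
Local Open Scope ring_scope.

Definition inspan (V : lmodType rat) (P : V -> Prop) (v : V) : Prop :=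
  exists s : seq (rat * V),
    (forall p, p \in s -> P p.2) /\ v = \sum_(p <- s) p.1 *: p.2.

(* A subquotient Z/B of an ambient Q-vector space V (Z, B subspaces,
   B contained in Z).  [sq_iso Z1 B1 Z2 B2] says that there is a Q-linear
   isomorphism Z1/B1 ~= Z2/B2, presented as a Q-linear map on Z1 with
   values in Z2 mapping B1 into B2 and inducing a bijection of quotients. *)
Definition sq_iso (V W : lmodType rat) (Z1 B1 : V -> Prop) (Z2 B2 : W -> Prop)
  : Prop :=
  exists f : V -> W,
    [/\ (forall (a : rat) x y, Z1 x -> Z1 y -> f (a *: x + y) = a *: f x + f y),
        (forall x, Z1 x -> Z2 (f x)),
        (forall x, B1 x -> B2 (f x)),
        (forall x, Z1 x -> B2 (f x) -> B1 x) &
        (forall y, Z2 y -> exists2 x, Z1 x & B2 (f x - y))].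

Definition dsumZ (V W : lmodType rat) (Z1 : V -> Prop) (Z2 : W -> Prop)
  : V * W -> Prop := fun p => Z1 p.1 /\ Z2 p.2.

(* Let V be a Q-vector space, S a subspace (given as a predicate).     *)
(* The p-th tensor power of S is the free Q-vector space on the words  *)
(* [x_1;...;x_p] (x_i in S), i.e. {malg rat[seq V]} restricted to such *)
(* words, modulo the multilinearity relations; wedge^p S is moreover   *)
(* the quotient by words with a repeated letter.                       *)

Section Wedge.
Variable V : lmodType rat.

Definition FreeT := {malg rat[seq V]}.

Definition word (S : V -> Prop) (p : nat) (k : seq V) : Prop :=
  size k = p /\ (forall x, x \in k -> S x).

Definition chains (S : V -> Prop) (p : nat) (c : FreeT) : Prop :=
  forall k, k \in msupp c -> word S p k.

Definition wedge_rel_gen (S : V -> Prop) (p : nat) (c : FreeT) : Prop :=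
  (exists (l r : seq V) (a : rat) (x y : V),
      [/\ word S p (l ++ x :: r), S y &
          c = << l ++ (a *: x + y) :: r >> - a *: << l ++ x :: r >>
              - << l ++ y :: r >> ])
  \/ (exists k : seq V, [/\ word S p k, ~~ uniq k & c = << k >>]).

Definition wedge_rel (S : V -> Prop) (p : nat) : FreeT -> Prop :=
  inspan (wedge_rel_gen S p).

(* wedge^p S = chains S p / wedge_rel S p *)

Variable bracket : V -> V -> V.

(* the Chevalley--Eilenberg boundary on a word [x_1;...;x_p]:
   sum_{i<j} (-1)^(i+j) [x_i,x_j] x_1 .. ^x_i .. ^x_j .. x_p          *)
Definition ce_word (k : seq V) : FreeT :=
  \sum_(i < size k) \sum_(j < size k | (i < j)%N)
     (-1) ^+ (i + j) *:
       << bracket (nth 0 k i) (nth 0 k j)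
            :: [seq nth 0 k m | m <- iota 0 (size k) & (m != i :> nat) && (m != j :> nat)] >>.

Definition ce_bd (c : FreeT) : FreeT :=
  \sum_(k <- msupp c) c@_k *: ce_word k.

(* Lie algebra homology H_p(S) of the Lie subalgebra S, as subquotient:
   cycles: chains whose boundary vanishes in wedge^(p-1) S,
   boundaries: R_p + image of the boundary of (p+1)-chains.           *)
Definition ceZ (S : V -> Prop) (p : nat) (c : FreeT) : Prop :=
  chains S p c /\ wedge_rel S p.-1 (ce_bd c).

Definition ceB (S : V -> Prop) (p : nat) : FreeT -> Prop :=
  inspan (fun c => wedge_rel_gen S p c \/
                   exists k, word S p.+1 k /\ c = ce_bd << k >>).

End Wedge.

Section Goldman.
Variables (H : zmodType) (form : H -> H -> int).

Definition QH := @malg H rat.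

Definition gbracket (f g : QH) : QH :=
  \sum_(x <- msupp f) \sum_(y <- msupp g)
     (f@_x * g@_y * (form x y)%:~R) *: << x + y >>.

(* kernel of mu : H -> Hom(H,Z), mu(x)(y) = <x,y> *)
Definition kermu (z : H) : Prop := forall y, form z y = 0.

Definition Qspan (S : H -> Prop) (f : QH) : Prop :=
  forall x, x \in msupp f -> S x.

Definition derived (f : QH) : Prop :=
  inspan (fun g => exists a b, g = gbracket a b) f.

Definition QHall : QH -> Prop := fun _ => True.

(* bigoplus_{z in ker mu} Q (x)_Z (H / Z z), as a subquotient of the   *)
(* free Q-vector space on triples (z, q, h), standing for the element  *)
(* q (x) [h] in the z-th summand (h a representative of its class in   *)
(* H/Zz), modulo the relations defining the tensor product over Z (as *)
(* a Q-vector space via the left factor) and the change of            *)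
(* representative.                                                    *)
Definition TFree := @malg (H * (rat * H))%type rat.

Definition tensZ (c : TFree) : Prop :=
  forall t, t \in msupp c -> kermu t.1.

Definition tens_rel_gen (c : TFree) : Prop :=
  exists (z : H) (q q' : rat) (h h' : H), kermu z /\
  [\/ c = << (z, (q + q', h)) >> - << (z, (q, h)) >> - << (z, (q', h)) >>,
      c = << (z, (q, h + h')) >> - << (z, (q, h)) >> - << (z, (q, h')) >>,
      c = q' *: << (z, (q, h)) >> - << (z, (q' * q, h)) >> |
      (exists n : int, h' = h + z *~ n) /\
      c = << (z, (q, h)) >> - << (z, (q, h')) >> ].

Definition tensB : TFree -> Prop := inspan tens_rel_gen.

End Goldman.

(* Main.v *)
Require Import Defs.
From HB Require Import structures.
From mathcomp Require Import all_boot all_order all_algebra.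
From mathcomp Require Import finmap.
From mathcomp Require Import monalg.
From mathcomp Require Import ring lra zify.
From Stdlib Require Import ClassicalEpsilon.
Import Order.TTheory GRing.Theory Num.Theory.
Local Open Scope ring_scope.
Set Implicit Arguments. Unset Strict Implicit. Unset Printing Implicit Defensive.

(* Write [phi w x] for [x] ^ [w - x].  The complex is graded by H.

   In a degree w outside ker mu, the boundary of [x] ^ [y] ^ [w - x - y] gives
   a relation whose comparison with the one for (2x, 2y) yields
   <x,w> phi w y ~ <y,w> phi w x, so every cycle of degree w bounds.
   In a degree z in ker mu every 2-chain is a cycle, and the boundaries say
   exactly that phi z is additive on pairs with <x,y> <> 0; as finitely many
   elements outside ker mu have a common y pairing nontrivially with all of
   them, phi z extends to an additive map on H killing z.  Hence
   [x] ^ [y] |-> 1 (x) x, placed in the summand x + y when it lies in ker mu,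
   induces the first isomorphism.

   For the second one, Q[ker mu] is central and Q[H]^(1) is perfect, so mixed
   words [w] ^ [z] are boundaries and projecting the letters of words to the
   two summands splits H_2. *)

(** * Spans and linear extensions *)

Section Span.
Variables (V : lmodType rat) (P : V -> Prop).

Lemma inspan_gen v : P v -> inspan P v.
Proof.
move=> Pv; exists [:: (1, v)]; split; last by rewrite big_seq1 scale1r.
by move=> p; rewrite inE => /eqP ->.
Qed.

Lemma inspan0 : inspan P 0.
Proof. by exists [::]; rewrite big_nil. Qed.

Lemma inspanD u v : inspan P u -> inspan P v -> inspan P (u + v).
Proof.
move=> [s [hs ->]] [t [ht ->]]; exists (s ++ t); rewrite big_cat; split=> // p.
by rewrite mem_cat => /orP[/hs|/ht].
Qed.

Lemma inspanZ a v : inspan P v -> inspan P (a *: v).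
Proof.
move=> [s [hs ->]]; exists [seq (a * p.1, p.2) | p <- s]; split.
  by move=> p /mapP[q /hs Pq ->].
by rewrite big_map scaler_sumr; apply: eq_bigr => p _; rewrite scalerA.
Qed.

Lemma inspanN v : inspan P v -> inspan P (- v).
Proof. by rewrite -scaleN1r; exact: inspanZ. Qed.

Lemma inspanB u v : inspan P u -> inspan P v -> inspan P (u - v).
Proof. by move=> hu /inspanN; exact: inspanD. Qed.

Lemma inspanZK a v : a != 0 -> inspan P (a *: v) -> inspan P v.
Proof. by move=> a0 /(inspanZ a^-1); rewrite scalerK. Qed.

Lemma inspan_eq u v : inspan P u -> v = u -> inspan P v.
Proof. by move=> h ->. Qed.

(** Closure under a linear identity that holds only modulo the span: [w] differs from [a *: u + v]
    by an element of it. *)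
Lemma inspan_defect a u v w :
  inspan P (w - a *: u - v) -> inspan P u -> inspan P v -> inspan P w.
Proof.
move=> h /(inspanZ a) hu hv; apply: inspan_eq (inspanD h (inspanD hu hv)) _.
by rewrite -[X in X + _]addrA -opprD subrK.
Qed.

Lemma inspan_ind (W : V -> Prop) :
    W 0 -> (forall a u v, W u -> W v -> W (a *: u + v)) ->
    (forall v, P v -> W v) ->
  forall v, inspan P v -> W v.
Proof.
move=> W0 WD PW _ [s [hs ->]]; elim: s hs => [|p s IHs] hs; first by rewrite big_nil.
rewrite big_cons; apply: WD; first by apply/PW/hs/mem_head.
by apply: IHs => q qs; apply: hs; rewrite inE qs orbT.
Qed.

End Span.

Lemma inspan_map (V W : lmodType rat) (f : {linear V -> W})
    (P : V -> Prop) (Q : W -> Prop) v :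
  (forall u, P u -> inspan Q (f u)) -> inspan P v -> inspan Q (f v).
Proof.
move=> PQ; move: v; apply: inspan_ind => //; first by rewrite linear0; exact: inspan0.
by move=> a u v hu hv; rewrite linearP; apply: inspanD => //; exact: inspanZ.
Qed.

Lemma inspan_sub (V : lmodType rat) (P Q : V -> Prop) v :
  (forall u, P u -> inspan Q u) -> inspan P v -> inspan Q v.
Proof. exact: (inspan_map (f := idfun)). Qed.

Section LinearExtension.
Variables (K : choiceType) (W : lmodType rat).
Implicit Types (F : K -> W) (c : {malg rat[K]}).

(** The body copies that of [ce_bd], so the boundary is [mlin (ce_word br)] by conversion. *)
Definition mlin F c : W := \sum_(k <- msupp c) c@_k *: F k.

Lemma mlinEw F (d : {fset K}) c :
  (msupp c `<=` d)%fset -> mlin F c = \sum_(k <- d) c@_k *: F k.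
Proof.
move=> sd; apply: (big_fset_incl _ sd) => k _ /mcoeff_outdom ->.
by rewrite scale0r.
Qed.

Lemma mlin_is_linear F : linear (mlin F).
Proof.
move=> a u v; pose d := (msupp (a *: u + v) `|` (msupp u `|` msupp v))%fset.
have du : (msupp u `<=` d)%fset by rewrite /d fsetUCA fsubsetUl.
have dv : (msupp v `<=` d)%fset by rewrite /d fsetUA fsubsetUr.
rewrite (mlinEw F du) (mlinEw F dv) (@mlinEw F d) ?fsubsetUl //.
rewrite scaler_sumr -big_split; apply: eq_bigr => k _ /=.
by rewrite mcoeffD mcoeffZ scalerDl scalerA.
Qed.

HB.instance Definition _ F :=
  GRing.isLinear.Build rat {malg rat[K]} W *:%R (mlin F) (mlin_is_linear F).

Lemma mlinU F k : mlin F << k >> = F k.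
Proof. by rewrite (mlinEw F msuppU_le) big_seq_fset1 mcoeffUU scale1r. Qed.

(* Stated on variables: rewriting [mlinU] at several concrete words makes the
   unifier compare these words up to conversion, which diverges in practice. *)
Lemma mlinUB F x y : mlin F (<< x >> - << y >>) = F x - F y.
Proof. by rewrite linearB /= !mlinU. Qed.

Lemma mlinUBB F x y z : mlin F (<< x >> - << y >> - << z >>) = F x - F y - F z.
Proof. by rewrite !linearB /= !mlinU. Qed.

Lemma mlinUZB F a x y : mlin F (a *: << x >> - << y >>) = a *: F x - F y.
Proof. by rewrite linearB linearZ /= !mlinU. Qed.

Lemma mlinUBZB F a x y z :
  F x = a *: F y + F z -> mlin F (<< x >> - a *: << y >> - << z >>) = 0.
Proof. by move=> h; rewrite !linearB linearZ /= !mlinU h -addrA -opprD subrr. Qed.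

Lemma mlinUBZ F a x y z :
  mlin F (<< x >> - a *: << y >> - << z >>) = F x - a *: F y - F z.
Proof. by rewrite !linearB linearZ /= !mlinU. Qed.

Lemma eq_mlin F G c : (forall k, k \in msupp c -> F k = G k) -> mlin F c = mlin G c.
Proof. by move=> FG; apply: eq_big_seq => k /FG ->. Qed.

Lemma mlin0 c : mlin (fun=> 0) c = 0.
Proof. by apply: big1 => k _; rewrite scaler0. Qed.

Lemma mlinUNDB F x y z : mlin F (- << x >> + << y >> - << z >>) = - F x + F y - F z.
Proof. by rewrite linearB linearD linearN /= !mlinU. Qed.

End LinearExtension.

Lemma mlin_id (K : choiceType) (c : {malg rat[K]}) : mlin (fun k => << k >>) c = c.
Proof.
rewrite [RHS]monalgE; apply: eq_bigr => k _.
by apply/malgP=> k'; rewrite mcoeffZ !mcoeffU mulrnAr mulr1.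
Qed.

Lemma mlin_comp (K L : choiceType) (W : lmodType rat) (F : L -> W)
    (G : K -> {malg rat[L]}) c :
  mlin F (mlin G c) = mlin (fun k => mlin F (G k)) c.
Proof.
by rewrite {2}/mlin linear_sum /=; apply: eq_bigr => k _; rewrite linearZ.
Qed.

Definition suppin (K : choiceType) (S : K -> Prop) (c : {malg rat[K]}) :=
  forall k, k \in msupp c -> S k.

Section SupportedIn.
Variables (K : choiceType) (S : K -> Prop).
Implicit Types c u v : {malg rat[K]}.

Lemma suppin0 : suppin S 0.
Proof. by move=> k; rewrite msupp0. Qed.

Lemma suppinU k : S k -> suppin S << k >>.
Proof. by move=> Sk k' /(fsubsetP msuppU_le); rewrite inE => /eqP ->. Qed.

Lemma suppinP a u v : suppin S u -> suppin S v -> suppin S (a *: u + v).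
Proof.
move=> hu hv k /(fsubsetP (msuppD_le _ _)).
by rewrite inE => /orP[/(fsubsetP (msuppZ_le _ _))/hu|/hv].
Qed.

Lemma suppinZ a u : suppin S u -> suppin S (a *: u).
Proof. by move=> hu; rewrite -[_ *: _]addr0; apply: suppinP => //; exact: suppin0. Qed.

Lemma suppinD u v : suppin S u -> suppin S v -> suppin S (u + v).
Proof. by rewrite -{2}[u]scale1r; exact: suppinP. Qed.

Lemma suppin_mlin (L : choiceType) (F : L -> {malg rat[K]}) (c : {malg rat[L]}) :
  (forall k, k \in msupp c -> suppin S (F k)) -> suppin S (mlin F c).
Proof.
move=> h; rewrite /mlin big_seq; apply: (big_ind (suppin S)).
- exact: suppin0.
- exact: suppinD.
- by move=> k /h; exact: suppinZ.
Qed.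

(** Words are formal symbols and depend linearly on a letter only modulo the wedge relations.
    Linearity of [G] up to [inspan P] still reduces a claim to basis elements. *)
Lemma inspan_linear_mod (W : lmodType rat) (P : W -> Prop)
    (G : {malg rat[K]} -> W) :
    (forall a u v, suppin S u -> suppin S v ->
       inspan P (G (a *: u + v) - a *: G u - G v)) ->
    (forall k, S k -> inspan P (G << k >>)) ->
  forall u, suppin S u -> inspan P (G u).
Proof.
move=> Glin GU u hu.
have G0 : inspan P (G 0).
  (* At scalar 1 and vectors 0 the defect of linearity is [- G 0]. *)
  have := inspanN (Glin 1 0 0 suppin0 suppin0).
  by rewrite scaler0 addr0 scale1r subrr sub0r opprK.
rewrite -[X in G X]mlin_id /mlin.
suff gen (s : seq K) : (forall k, k \in s -> S k) ->
    inspan P (G (\sum_(k <- s) u@_k *: << k >>)) by apply: gen; exact: hu.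
elim: s => [|k s IHs] hs; first by rewrite big_nil.
have Sk : S k by apply/hs/mem_head.
have hs' : forall k', k' \in s -> S k' by move=> k' k's; apply: hs; rewrite inE k's orbT.
have sU : suppin S (\sum_(i <- s) u@_i *: << i >>).
  rewrite big_seq; apply: (big_ind (suppin S)); [exact: suppin0 | exact: suppinD | ].
  by move=> i /hs' Si; exact/suppinZ/suppinU.
rewrite big_cons.
exact: inspan_defect (Glin u@_k _ _ (suppinU Sk) sU) (GU _ Sk) (IHs hs').
Qed.

Lemma inspan_linear (W : lmodType rat) (P : W -> Prop) (G : {malg rat[K]} -> W) :
    (forall a u v, G (a *: u + v) = a *: G u + G v) ->
    (forall k, S k -> inspan P (G << k >>)) ->
  forall u, suppin S u -> inspan P (G u).
Proof.
move=> Glin; apply: inspan_linear_mod => a u v _ _.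
by rewrite Glin -addrA -opprD subrr; exact: inspan0.
Qed.

End SupportedIn.

Section BilinearExtension.
Variables (K L : choiceType) (W : lmodType rat) (F : K -> L -> W).

Definition bilin (a : {malg rat[K]}) (b : {malg rat[L]}) : W :=
  mlin (fun x => mlin (F x) b) a.

Lemma bilinPl b k u v : bilin (k *: u + v) b = k *: bilin u b + bilin v b.
Proof. by rewrite /bilin linearP. Qed.

Lemma bilinPr a k u v : bilin a (k *: u + v) = k *: bilin a u + bilin a v.
Proof.
rewrite /bilin /mlin scaler_sumr -big_split; apply: eq_bigr => x _ /=.
by rewrite -/(mlin (F x) _) linearP scalerDr !scalerA mulrC.
Qed.

Lemma bilinZl b k u : bilin (k *: u) b = k *: bilin u b.
Proof. by rewrite /bilin linearZ. Qed.

Lemma bilinUU x y : bilin << x >> << y >> = F x y.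
Proof. by rewrite /bilin !mlinU. Qed.

End BilinearExtension.

(* Identities between linear combinations are decided by comparing the
   coefficients of each atom. *)
Inductive mexp :=
  | MVar of nat | MAdd of mexp & mexp | MOpp of mexp | MScale of rat & mexp | MZero.

Fixpoint mcf (i : nat) (e : mexp) : rat :=
  match e with
  | MVar n => if eqn n i then 1 else 0
  | MAdd e1 e2 => mcf i e1 + mcf i e2
  | MOpp e1 => - mcf i e1
  | MScale a e1 => a * mcf i e1
  | MZero => 0
  end.

(** Recursion on the number of atoms lets [cbn] unfold this to one equation in [rat] per atom. *)
Fixpoint same_mcf (i n : nat) (e1 e2 : mexp) : Prop :=
  if n is n'.+1 then mcf i e1 = mcf i e2 /\ same_mcf i.+1 n' e1 e2 else True.

Section ModuleExpressions.
Variables (V : lmodType rat) (env : seq V).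

Fixpoint meval (e : mexp) : V :=
  match e with
  | MVar n => nth 0 env n
  | MAdd e1 e2 => meval e1 + meval e2
  | MOpp e1 => - meval e1
  | MScale a e1 => a *: meval e1
  | MZero => 0
  end.

Lemma mevalE e : meval e = \sum_(i < size env) mcf i e *: nth 0 env i.
Proof.
elim: e => [n|e1 IH1 e2 IH2|e1 IH1|a e1 IH1|] /=.
- case: (ltnP n (size env)) => hn.
    rewrite (bigD1 (Ordinal hn)) //= eqnE eqxx scale1r big1 ?addr0 // => i ni.
    by move: ni; rewrite -val_eqE /= eq_sym => /negbTE ->; rewrite scale0r.
  rewrite nth_default // big1 // => i _; rewrite eqnE.
  by rewrite gtn_eqF ?scale0r // (leq_trans (ltn_ord i)).
- by rewrite IH1 IH2 -big_split; apply: eq_bigr => i _; rewrite scalerDl.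
- by rewrite IH1 -sumrN; apply: eq_bigr => i _; rewrite scaleNr.
- by rewrite IH1 scaler_sumr; apply: eq_bigr => i _; rewrite scalerA.
- by rewrite big1 // => i _; rewrite scale0r.
Qed.

Lemma meval_eq e1 e2 : same_mcf 0 (size env) e1 e2 -> meval e1 = meval e2.
Proof.
move=> h; rewrite !mevalE; apply: eq_bigr => [[i hi]] _ /=; congr (_ *: _).
suff gen n m : same_mcf m n e1 e2 -> forall i, (m <= i < m + n)%N -> mcf i e1 = mcf i e2.
  by apply: gen h _ _.
elim: n m => [|n IHn] m /=; first by move=> _ j; rewrite addn0; case: ltngtP.
move=> [e0 hm] j /andP[mj jn]; case: (ltngtP m j) mj => // [mj _|<- //].
by apply: (IHn m.+1) => //; rewrite mj addSnnS.
Qed.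

End ModuleExpressions.

Ltac atom_index t env :=
  lazymatch env with
  | t :: _ => constr:(0%N)
  | _ :: ?env' => let n := atom_index t env' in constr:(n.+1)
  end.
Ltac mem_atom t env :=
  lazymatch env with
  | nil => constr:(false)
  | t :: _ => constr:(true)
  | _ :: ?env' => mem_atom t env'
  end.
Ltac atoms t env :=
  lazymatch t with
  | @GRing.add _ ?u ?v => let env' := atoms u env in atoms v env'
  | @GRing.opp _ ?u => atoms u env
  | @GRing.scale _ _ _ ?u => atoms u env
  | @GRing.zero _ => env
  | _ => lazymatch mem_atom t env with true => env | false => constr:(t :: env) end
  end.
Ltac mreify t env :=
  lazymatch t with
  | @GRing.add _ ?u ?v =>
      let eu := mreify u env in let ev := mreify v env in constr:(MAdd eu ev)
  | @GRing.opp _ ?u => let eu := mreify u env in constr:(MOpp eu)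
  | @GRing.scale _ _ ?a ?u => let eu := mreify u env in constr:(MScale a eu)
  | @GRing.zero _ => constr:(MZero)
  | _ => let n := atom_index t env in constr:(MVar n)
  end.
Ltac module_coeffs :=
  match goal with |- @eq ?T ?u ?v =>
    let env := atoms u (@nil T) in let env := atoms v env in
    let eu := mreify u env in let ev := mreify v env in
    refine (@meval_eq _ env eu ev _);
    cbn [same_mcf mcf size eqn]; repeat split
  end.
Ltac module_ring := module_coeffs; ring.

(** * Words of length two and three *)

Section SumPairs.
Variables (W : zmodType) (F : nat -> nat -> W).

Lemma sum_pairs2 : \sum_(i < 2) \sum_(j < 2 | (i < j)%N) F i j = F 0 1.
Proof.
under eq_bigr do rewrite big_mkcond.
by rewrite !big_ord_recl !big_ord0 /= /bump /= !(addr0, add0r).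
Qed.

Lemma sum_pairs3 :
  \sum_(i < 3) \sum_(j < 3 | (i < j)%N) F i j = F 0 1 + F 0 2 + F 1 2.
Proof.
under eq_bigr do rewrite big_mkcond.
by rewrite !big_ord_recl !big_ord0 /= /bump /= !(addr0, add0r).
Qed.

End SumPairs.

Section ShortWords.
Variables (V : lmodType rat) (S : V -> Prop).
Implicit Types a b x y : V.

Definition wd1 a : FreeT V := << [:: a] >>.
Definition wd2 a b : FreeT V := << [:: a; b] >>.

Lemma word2 a b : S a -> S b -> word S 2 [:: a; b].
Proof. by move=> Sa Sb; split=> // x; rewrite !inE => /orP[]/eqP ->. Qed.

Lemma word3 a b c : S a -> S b -> S c -> word S 3 [:: a; b; c].
Proof. by move=> Sa Sb Sc; split=> // x; rewrite !inE => /or3P[]/eqP ->. Qed.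

Lemma wd1_lin k x y : S x -> S y ->
  wedge_rel S 1 (wd1 (k *: x + y) - k *: wd1 x - wd1 y).
Proof.
move=> Sx Sy; apply: inspan_gen; left; exists [::], [::], k, x, y; split=> //.
by split=> // t; rewrite inE => /eqP ->.
Qed.

Lemma wd2_linl k x y b : S x -> S y -> S b ->
  wedge_rel S 2 (wd2 (k *: x + y) b - k *: wd2 x b - wd2 y b).
Proof.
move=> Sx Sy Sb; apply: inspan_gen; left; exists [::], [:: b], k, x, y.
by split=> //; exact: word2.
Qed.

Lemma wd2_linr k a x y : S a -> S x -> S y ->
  wedge_rel S 2 (wd2 a (k *: x + y) - k *: wd2 a x - wd2 a y).
Proof.
move=> Sa Sx Sy; apply: inspan_gen; left; exists [:: a], [::], k, x, y.
by split=> //; exact: word2.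
Qed.

Lemma wd2_diag a : S a -> wedge_rel S 2 (wd2 a a).
Proof.
move=> Sa; apply: inspan_gen; right; exists [:: a; a]; split=> //; first exact: word2.
by rewrite /= inE eqxx.
Qed.

(** A word with letter 0 is a nonzero formal symbol; it is minus the multilinearity relation at
    scalar 1 and letters 0. *)
Lemma wd1_0 : S 0 -> wedge_rel S 1 (wd1 0).
Proof.
move=> S0; apply: inspan_eq (inspanN (wd1_lin 1 S0 S0)) _.
by rewrite scaler0 addr0 scale1r subrr sub0r opprK.
Qed.

Lemma wd2_0l b : S 0 -> S b -> wedge_rel S 2 (wd2 0 b).
Proof.
move=> S0 Sb; apply: inspan_eq (inspanN (wd2_linl 1 S0 S0 Sb)) _.
by rewrite scaler0 addr0 scale1r subrr sub0r opprK.
Qed.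

Lemma wd2_Zl k x b : S 0 -> S x -> S b ->
  wedge_rel S 2 (wd2 (k *: x) b - k *: wd2 x b).
Proof.
move=> S0 Sx Sb.
apply: inspan_eq (inspanD (wd2_linl k Sx S0 Sb) (wd2_0l S0 Sb)) _.
by rewrite addr0 subrK.
Qed.

(** Polarization: the relations only kill repeated letters, so the sign rule comes from expanding
    the word with both letters [1 *: a + b]. *)
Lemma wd2_anti a b : (forall k x y, S x -> S y -> S (k *: x + y)) ->
  S a -> S b -> wedge_rel S 2 (wd2 a b + wd2 b a).
Proof.
move=> Slin Sa Sb; have Sab := Slin 1 _ _ Sa Sb.
have h := inspanD (wd2_linl 1 Sa Sb Sab)
  (inspanD (wd2_linr 1 Sa Sa Sb) (wd2_linr 1 Sb Sa Sb)).
apply: inspan_eq (inspanD (inspanN h) (inspanB (wd2_diag Sab)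
  (inspanD (wd2_diag Sa) (wd2_diag Sb)))) _.
module_ring.
Qed.

Lemma size_cat_cons1 (l r : seq V) x :
  size (l ++ x :: r) = 1%N -> l = [::] /\ r = [::].
Proof. by case: l r => [|? [|? ?]] [|? ?]. Qed.

Lemma size_cat_cons2 (l r : seq V) x : size (l ++ x :: r) = 2 ->
  (l = [::] /\ exists b, r = [:: b]) \/ (r = [::] /\ exists a, l = [:: a]).
Proof.
case: l r => [|a [|? [|? ?]]] [|b [|? ?]] //= _; [left | right].
  by split=> //; exists b.
by split=> //; exists a.
Qed.

Lemma word2P k : word S 2 k -> exists a b, [/\ k = [:: a; b], S a & S b].
Proof.
case: k => [|a [|b [|? ?]]] [] //= _ h; exists a, b.
by split=> //; apply: h; rewrite !inE eqxx ?orbT.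
Qed.

Lemma word3P k : word S 3 k ->
  exists a b c, [/\ k = [:: a; b; c], S a, S b & S c].
Proof.
case: k => [|a [|b [|c [|? ?]]]] [] //= _ h; exists a, b, c.
by split=> //; apply: h; rewrite !inE eqxx ?orbT.
Qed.

Variable br : V -> V -> V.

Lemma ce_bd_lin k u v : ce_bd br (k *: u + v) = k *: ce_bd br u + ce_bd br v.
Proof. exact: (mlin_is_linear (ce_word br)). Qed.

Lemma ce_bd0 : ce_bd br 0 = 0.
Proof. exact: (linear0 (mlin (ce_word br))). Qed.

Lemma ce_bdU k : ce_bd br << k >> = ce_word br k.
Proof. exact: mlinU. Qed.

Lemma ce_word2 a b : ce_word br [:: a; b] = - wd1 (br a b).
Proof.
pose k := [:: a; b].
rewrite /ce_word (sum_pairs2 (fun i j => (-1) ^+ (i + j) *: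
  << br (nth 0 k i) (nth 0 k j)
     :: [seq nth 0 k m | m <- iota 0 2 & (m != i) && (m != j)] >>)) /=.
by rewrite expr1 scaleN1r.
Qed.

(** Positions are counted from 0; shifting both indices by one keeps the parity of their sum, so the
    signs are the usual ones. *)
Lemma ce_word3 a b c : ce_word br [:: a; b; c] =
  - wd2 (br a b) c + wd2 (br a c) b - wd2 (br b c) a.
Proof.
pose k := [:: a; b; c].
rewrite /ce_word (sum_pairs3 (fun i j => (-1) ^+ (i + j) *:
  << br (nth 0 k i) (nth 0 k j)
     :: [seq nth 0 k m | m <- iota 0 3 & (m != i) && (m != j)] >>)) /=.
by rewrite expr1 sqrrN expr1n exprS sqrrN expr1n mulr1 !scaleN1r scale1r.
Qed.

Lemma ce_bd3 a b c : ce_bd br << [:: a; b; c] >> =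
  - wd2 (br a b) c + wd2 (br a c) b - wd2 (br b c) a.
Proof. by rewrite ce_bdU ce_word3. Qed.

End ShortWords.

(** * Functoriality of chains and relations in the subspace and in the letters *)

Section Monotonicity.
Variables (V : lmodType rat) (S S' : V -> Prop).
Hypothesis sSS' : forall x, S x -> S' x.

Lemma word_mono p k : word S p k -> word S' p k.
Proof. by move=> [hp hk]; split=> // x /hk /sSS'. Qed.

Lemma chains_mono p c : chains S p c -> chains S' p c.
Proof. by move=> hc k /hc /word_mono. Qed.

Lemma wedge_rel_gen_mono p c : wedge_rel_gen S p c -> wedge_rel_gen S' p c.
Proof.
move=> [[l [r [a [x [y [hw Sy ->]]]]]]|[k [hw nu ->]]]; [left | right].
  by exists l, r, a, x, y; split; [exact: word_mono | exact: sSS' |].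
by exists k; split=> //; exact: word_mono.
Qed.

Lemma wedge_rel_mono p c : wedge_rel S p c -> wedge_rel S' p c.
Proof. by apply: inspan_sub => u hu; apply/inspan_gen/wedge_rel_gen_mono. Qed.

Lemma ceB_mono br p c : ceB br S p c -> ceB br S' p c.
Proof.
apply: inspan_sub => u hu; apply: inspan_gen.
case: hu => [/wedge_rel_gen_mono|[k [/word_mono hk ->]]]; first by left.
by right; exists k.
Qed.

End Monotonicity.

Section WordMap.
Variables (V : lmodType rat) (p : {linear V -> V}).

Definition wmap : FreeT V -> FreeT V := mlin (fun k => << map p k >>).

Lemma wmap_lin k u v : wmap (k *: u + v) = k *: wmap u + wmap v.
Proof. exact: linearP. Qed.

Lemma wmap_wd2 a b : wmap (wd2 a b) = wd2 (p a) (p b).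
Proof. exact: mlinU. Qed.

Variables S S' : V -> Prop.
Hypothesis pS : forall x, S x -> S' (p x).

Lemma word_map n k : word S n k -> word S' n (map p k).
Proof.
by move=> [<- hk]; split; [rewrite size_map | move=> _ /mapP[x /hk/pS hx ->]].
Qed.

Lemma chains_wmap n c : chains S n c -> chains S' n (wmap c).
Proof.
move=> hc; apply: (@suppin_mlin _ (word S' n)) => k /hc hk.
by apply: suppinU; exact: word_map.
Qed.

(** Linearity of [p] carries a multilinearity relation to one of the same shape, and equal letters
    stay equal. *)
Lemma wedge_rel_gen_wmap n c : wedge_rel_gen S n c -> wedge_rel_gen S' n (wmap c).
Proof.
move=> [[l [r [a [x [y [/word_map hw /pS Sy ->]]]]]]|[k [/word_map hw nu ->]]].
  left; exists (map p l), (map p r), a, (p x), (p y); split=> //.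
    by rewrite map_cat in hw.
  by apply: etrans (mlinUBZ _ _ _ _ _) _; rewrite !map_cat /= linearP.
right; exists (map p k); split=> //; last exact: mlinU.
by apply: contra nu; exact: map_uniq.
Qed.

Lemma wedge_rel_wmap n c : wedge_rel S n c -> wedge_rel S' n (wmap c).
Proof. by apply: inspan_map => u hu; apply/inspan_gen/wedge_rel_gen_wmap. Qed.

End WordMap.

(** * The Goldman Lie algebra *)

Section Goldman.
Variables (H : zmodType) (form : H -> H -> int).
Hypotheses (form_addl : forall x y z, form (x + y) z = form x z + form y z)
  (form_addr : forall x y z, form x (y + z) = form x y + form x z)
  (form_alt : forall x, form x x = 0)
  (form_nz : exists x y, form x y != 0).
Implicit Types (x y z w h : H) (a b : QH H).

Local Notation br := (gbracket form).
Local Notation g := (derived form).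
Local Notation B := (ceB br g 2).

(** * The form with rational values and the complement of its kernel *)

Definition cf x y : rat := (form x y)%:~R.

Lemma cfDl x y z : cf (x + y) z = cf x z + cf y z.
Proof. by rewrite /cf form_addl intrD. Qed.

Lemma cfDr x y z : cf x (y + z) = cf x y + cf x z.
Proof. by rewrite /cf form_addr intrD. Qed.

Lemma cfxx x : cf x x = 0.
Proof. by rewrite /cf form_alt. Qed.

Lemma cf0l y : cf 0 y = 0.
Proof. by apply: (addrI (cf 0 y)); rewrite -cfDl !addr0. Qed.

Lemma cf0r y : cf y 0 = 0.
Proof. by apply: (addrI (cf y 0)); rewrite -cfDr !addr0. Qed.

Lemma cfNl x y : cf (- x) y = - cf x y.
Proof. by apply/eqP; rewrite -addr_eq0 -cfDl addNr cf0l. Qed.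

Lemma cfNr x y : cf x (- y) = - cf x y.
Proof. by apply/eqP; rewrite -addr_eq0 -cfDr addNr cf0r. Qed.

Lemma cf_anti x y : cf x y = - cf y x.
Proof.
apply/eqP; rewrite -addr_eq0.
by have := cfxx (x + y); rewrite cfDl !cfDr !cfxx add0r addr0 => ->.
Qed.

Let cfE := (cfDl, cfDr, cfNl, cfNr, cfxx).

Lemma cf_eq0 x y : (cf x y == 0) = (form x y == 0).
Proof. by rewrite intr_eq0. Qed.

Definition nk x := ~ kermu form x.

Lemma nkP x : nk x -> exists y, cf x y != 0.
Proof.
move=> /not_all_ex_not[y /eqP h]; by exists y; rewrite cf_eq0.
Qed.

Lemma kermu_cfl z y : kermu form z -> cf z y = 0.
Proof. by move=> hz; rewrite /cf hz. Qed.

Lemma kermu_cfr z y : kermu form z -> cf y z = 0.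
Proof. by move=> hz; rewrite cf_anti kermu_cfl // oppr0. Qed.

Lemma nkl x y : cf x y != 0 -> nk x.
Proof. by move=> + hx; rewrite kermu_cfl // eqxx. Qed.

Lemma nkr x y : cf x y != 0 -> nk y.
Proof. by move=> + hx; rewrite kermu_cfr // eqxx. Qed.

Lemma kermuD x y : kermu form x -> kermu form y -> kermu form (x + y).
Proof. by move=> hx hy z; rewrite form_addl hx hy. Qed.

Lemma kermuN x : kermu form x -> kermu form (- x).
Proof.
by move=> hx z; apply/eqP; rewrite -cf_eq0 cfNl kermu_cfl // oppr0.
Qed.

Lemma nkD x k : nk x -> kermu form k -> nk (x + k).
Proof. by move=> hx hk h; apply: hx; rewrite -(addrK k x); apply/kermuD/kermuN. Qed.

Lemma nkN x : nk x -> nk (- x).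
Proof. by move=> hx h; apply: hx; rewrite -(opprK x); exact: kermuN. Qed.

(** If the witness [y] of the tail fails on [x], it is replaced by a large multiple of [y] plus some
    [v] pairing nontrivially with [x]. *)
Lemma common_witness (s : seq H) :
  (forall x, x \in s -> nk x) -> exists y, forall x, x \in s -> cf x y != 0.
Proof.
elim: s => [|x s IHs] hs; first by exists 0.
have [|y hy] := IHs; first by move=> t ts; apply: hs; rewrite inE ts orbT.
have [xy0|xy0] := eqVneq (cf x y) 0; last first.
  by exists y => t; rewrite inE => /orP[/eqP ->|/hy].
have [v xv] := nkP (hs x (mem_head _ _)).
(* [N] exceeds every [|form t v|]; as [form t y] is a nonzero integer, [N * form t y] cannot be
   cancelled by [form t v]. *)
pose N := (\sum_(t <- s) `|form t v|%N).+1.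
have cfN t : cf t (y *+ N + v) = cf t y * N%:R + cf t v.
  rewrite cfDr; congr (_ + _); elim: (N) => [|n IHn]; first by rewrite cf0r mulr0.
  by rewrite mulrS cfDr IHn; ring.
exists (y *+ N + v) => t; rewrite inE cfN => /orP[/eqP ->|ts].
  by rewrite xy0 mul0r add0r.
have ty : form t y != 0 by rewrite -cf_eq0 hy.
have ltN : (`|form t v| < N)%N by rewrite ltnS (big_rem _ ts) leq_addr.
have -> : cf t y * N%:R + cf t v = (form t y * N%:Z + form t v)%:~R.
  by rewrite intrD intrM.
rewrite intr_eq0; move: ty ltN; nia.
Qed.

(** * The bracket and the derived subalgebra *)

Lemma brE a b : br a b = bilin (fun x y => cf x y *: << x + y >>) a b.
Proof.
rewrite /gbracket /bilin /mlin; apply: eq_bigr => x _.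
by rewrite scaler_sumr; apply: eq_bigr => y _; rewrite !scalerA.
Qed.

Lemma brU x y : br << x >> << y >> = cf x y *: << x + y >>.
Proof. by rewrite brE bilinUU. Qed.

Lemma br_linl k a a' b : br (k *: a + a') b = k *: br a b + br a' b.
Proof. by rewrite !brE bilinPl. Qed.

Lemma br_linr k a b b' : br a (k *: b + b') = k *: br a b + br a b'.
Proof. by rewrite !brE bilinPr. Qed.

(** If [cf x y] is nonzero, then so is [cf (x + y) y], which equals it. *)
Lemma br_nk a b : suppin nk (br a b).
Proof.
rewrite brE; apply: suppin_mlin => x _; apply: suppin_mlin => y _.
have [->|xy] := eqVneq (cf x y) 0; first by rewrite scale0r; exact: suppin0.
apply: suppinZ; apply: suppinU; apply: (@nkl _ y).
by rewrite !cfE addr0.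
Qed.

Lemma derivedP a : g a <-> suppin nk a.
Proof.
split.
  move: a; apply: inspan_ind; first exact: suppin0.
    by move=> k u v; exact: suppinP.
  by move=> _ [a [b ->]]; exact: br_nk.
apply: (inspan_linear (G := id)) => // x /nkP[y xy].
(* Conversely, [[x - y]] and [[y]] bracket to an invertible multiple of [[x]]. *)
have e : cf (x - y) y = cf x y by rewrite !cfE subr0.
apply: (@inspanZK _ _ (cf x y)) => //; apply: inspan_gen.
by exists << x - y >>, << y >>; rewrite brU subrK e.
Qed.

Lemma gU x : nk x -> g << x >>.
Proof. by move=> hx; apply/derivedP; exact: suppinU. Qed.

Lemma g0 : g 0.
Proof. exact: inspan0. Qed.

Lemma glin k a b : g a -> g b -> g (k *: a + b).
Proof. by move=> ga gb; apply: inspanD => //; exact: inspanZ. Qed.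

Lemma rel_ceB (S : QH H -> Prop) c : wedge_rel S 2 c -> ceB br S 2 c.
Proof. by apply: inspan_sub => u hu; apply: inspan_gen; left. Qed.

Lemma bd_ceB (S : QH H -> Prop) a b c : S a -> S b -> S c ->
  ceB br S 2 (wd2 (br a b) c - wd2 (br a c) b + wd2 (br b c) a).
Proof.
move=> Sa Sb Sc; have : ceB br S 2 (ce_bd br << [:: a; b; c] >>).
  by apply: inspan_gen; right; exists [:: a; b; c]; split=> //; exact: word3.
rewrite ce_bdU ce_word3 => /inspanN h; apply: inspan_eq h _; module_ring.
Qed.

Definition wdU x y : FreeT (QH H) := wd2 << x >> << y >>.

(** * Boundary relations between 2-words of a fixed degree *)

Definition phi w x := wdU x (w - x).

Lemma wdU_anti x y : nk x -> nk y -> B (wdU x y + wdU y x).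
Proof. by move=> hx hy; apply/rel_ceB/wd2_anti; [exact: glin | exact: gU | exact: gU]. Qed.

Definition wdbr x y u : FreeT (QH H) := wd2 (br << x >> << y >>) << u >>.

Lemma wdbr_scale x y u : nk u -> B (wdbr x y u - cf x y *: wdU (x + y) u).
Proof.
move=> hu; rewrite /wdbr brU; have [->|xy] := eqVneq (cf x y) 0.
  rewrite !scale0r subr0; apply: rel_ceB; apply: wd2_0l; [exact: g0 | exact: gU].
apply/rel_ceB/wd2_Zl; [exact: g0 | apply/gU/(@nkl _ y) | exact: gU].
by rewrite !cfE addr0.
Qed.

Lemma wdbr_bd x y u : nk x -> nk y -> nk u ->
  B (wdbr x y u - wdbr x u y + wdbr y u x).
Proof. by move=> /gU hx /gU hy /gU hu; exact: bd_ceB. Qed.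

(** With [u = w - x - y], the sums [x + u] and [y + u] are [w - y] and [w - x], so after
    antisymmetry all three terms of the boundary of [[x] ^ [y] ^ [u]] are values of [phi w]. *)
Lemma phi_bd w x y : nk x -> nk y -> nk (w - x - y) ->
  B (cf x y *: phi w (x + y) + (cf x w - cf x y) *: phi w y
     - (cf y w + cf x y) *: phi w x).
Proof.
set u := w - x - y => hx hy hu.
(* Antisymmetry needs [w - t] outside [ker mu]. This follows when the coefficient is nonzero;
   otherwise the term vanishes. *)
have swap t v : nk t -> B (cf v (w - t) *: (phi w t + wdU (w - t) t)).
  move=> ht; have [->|/nkr h] := eqVneq (cf v (w - t)) 0.
    by rewrite scale0r; exact: inspan0.
  by apply: inspanZ; rewrite /phi; exact: wdU_anti.
have ey : x + u = w - y by rewrite /u addrA [x + _]addrC subrK.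
have ex : y + u = w - x by rewrite /u addrC subrK.
have exy : u = w - (x + y) by rewrite /u opprD addrA.
have h1 := wdbr_bd hx hy hu.
have h2 := inspanB (inspanD (wdbr_scale x y hu) (wdbr_scale y u hx)) (wdbr_scale x u hy).
have h3 := inspanB (swap y x hy) (swap x y hx).
apply: inspan_eq (inspanD (inspanB h1 h2) h3) _.
rewrite ey ex.
have -> : wdU (x + y) u = phi w (x + y) by rewrite /phi exy.
have -> : cf x u = cf x w - cf x y by rewrite /u !cfE; ring.
have -> : cf y u = cf y w + cf x y by rewrite /u !cfE (cf_anti y x); ring.
rewrite !cfE (cf_anti y x) opprK.
module_ring.
Qed.

(* In a degree [w] outside [ker mu] every [phi w x] is proportional to
   [cf x w]: comparing the boundary relation at [(x, y)] with the one at
   [(2x, 2y)], whose two sides scale differently, separates them. *)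
Lemma phi_bd0 w x y : cf x y = 0 -> nk x -> nk y -> nk (w - x - y) ->
  B (cf x w *: phi w y - cf y w *: phi w x).
Proof.
move=> xy hx hy hu; apply: inspan_eq (phi_bd hx hy hu) _.
rewrite xy; module_ring.
Qed.

(** This is the relation at [(x, 2x)], where the form vanishes; the third letter [w - 3x] pairs with
    [w] to [-3 * cf x w]. *)
Lemma phi_double w x : cf x w != 0 -> B (phi w (x + x) - 2 *: phi w x).
Proof.
move=> xw.
have h2 : nk (x + x) by apply: (@nkl _ w); rewrite cfDl; apply: contra_neq xw => ?; lra.
have h3 : nk (w - x - (x + x)).
  apply: (@nkl _ w); rewrite opprD !cfE.
  by apply: contra_neq xw => ?; lra.
have xx : cf x (x + x) = 0 by rewrite !cfE addr0.
apply: (inspanZK xw); apply: inspan_eq (phi_bd0 xx (nkl xw) h2 h3) _.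
rewrite cfDl; module_ring.
Qed.

(** The hypothesis on the sum makes doubling available at [x + y] and keeps [w - x - y] outside
    [ker mu]. *)
Lemma phi_prop_generic w x y : cf x w != 0 -> cf y w != 0 -> cf x w + cf y w != 0 ->
  B (cf x w *: phi w y - cf y w *: phi w x).
Proof.
move=> xw yw xyw.
have dbl t : cf t w != 0 -> cf (t + t) w != 0 by rewrite cfDl; apply: contra_neq => ?; lra.
have hu : nk (w - x - y) by apply: (@nkl _ w); rewrite !cfE; apply: contra_neq xyw => ?; lra.
have hu2 : nk (w - (x + x) - (y + y)).
  by apply: (@nkl _ w); rewrite !cfE; apply: contra_neq xyw => ?; lra.
have xyw' : cf (x + y) w != 0 by rewrite cfDl.
have h1 := phi_bd (nkl xw) (nkl yw) hu.
have h2 := phi_bd (nkl (dbl _ xw)) (nkl (dbl _ yw)) hu2.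
have hx := phi_double xw; have hy := phi_double yw; have hxy := phi_double xyw'.
have e : x + x + (y + y) = x + y + (x + y) by exact: addrACA.
rewrite e in h2.
have h3 := inspanD (inspanD (inspanZ (4 * cf x y) hxy)
  (inspanZ (2 * cf x w - 4 * cf x y) hy)) (inspanZ (- (2 * cf y w + 4 * cf x y)) hx).
(* At [(2x, 2y)] the coefficient [cf x y] is multiplied by 4, those with [w] by 2, and every [phi]
   doubles. Subtracting this from 8 times the relation at [(x, y)] removes [cf x y] and leaves 4
   times the claim. *)
apply: (@inspanZK _ _ 4) => //.
apply: inspan_eq (inspanB (inspanZ 8 h1) (inspanB h2 h3)) _.
rewrite !cfE; module_ring.
Qed.

Lemma phi_prop w x y : cf x w != 0 -> cf y w != 0 ->
  B (cf x w *: phi w y - cf y w *: phi w x).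
Proof.
move=> xw yw; have [e|ne] := eqVneq (cf x w + cf y w) 0; last exact: phi_prop_generic.
(* In the exceptional case [2y] replaces [y]: then [cf x w + cf (y + y) w] is [cf y w], and doubling
   returns to [y]. *)
have yw2 : cf (y + y) w != 0 by rewrite cfDl; apply: contra_neq yw => ?; lra.
have ne : cf x w + cf (y + y) w != 0 by rewrite cfDl addrA e add0r.
have h := phi_prop_generic xw yw2 ne.
apply: (@inspanZK _ _ 2) => //.
apply: inspan_eq (inspanB h (inspanZ (cf x w) (phi_double yw))) _.
rewrite cfDl; module_ring.
Qed.

(** For [y] pairing nontrivially with [w] and [w - x], proportionality identifies [phi w (x + y)]
    with [phi w y]. The relation at [(x, y)] then leaves [phi w x] with coefficient
    [cf y (w - x)]. *)
Lemma phi_orth w x : cf x w = 0 -> nk w -> nk x -> nk (w - x) -> B (phi w x).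
Proof.
move=> xw hw hx hwx.
have [|y hy] := @common_witness [:: w; w - x].
  by move=> t; rewrite !inE => /orP[]/eqP ->.
have yw : cf y w != 0 by rewrite cf_anti oppr_eq0 hy ?mem_head.
have /hy {hy} : w - x \in [:: w; w - x] by rewrite !inE eqxx orbT.
rewrite !cfE => ywx.
have hu : nk (w - x - y) by apply: (@nkl _ w); rewrite !cfE xw; apply: contra_neq yw => ?; lra.
have xyw : cf (x + y) w != 0 by rewrite cfDl xw add0r.
have h1 := phi_bd hx (nkl yw) hu.
have h2 := phi_prop yw xyw.
have {}h2 : B (phi w (x + y) - phi w y).
  by apply: (inspanZK yw); apply: inspan_eq h2 _; rewrite cfDl xw; module_ring.
apply: (@inspanZK _ _ (cf y w + cf x y)).
  by move: ywx; rewrite (cf_anti w y); apply: contra_neq => ?; lra.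
apply: inspan_eq (inspanB (inspanZ (cf x y) h2) h1) _.
rewrite xw; module_ring.
Qed.

(** Since [[x]] and [[w - x]] bracket to [cf x w] times [[w]], this recovers a 2-word of degree [w]
    from its bracket, modulo boundaries. *)
Lemma phi_section w x y : nk w -> nk x -> nk (w - x) -> cf y w != 0 ->
  B (phi w x - cf x w *: ((cf y w)^-1 *: phi w y)).
Proof.
move=> hw hx hwx yw; have [xw|xw] := eqVneq (cf x w) 0.
  by rewrite xw scale0r subr0; exact: phi_orth.
apply: (inspanZK yw); apply: inspan_eq (inspanN (phi_prop xw yw)) _.
by module_coeffs; field.
Qed.

(** Lying in [ker mu] quantifies over all of [H], so a boolean test requires a classical
    decision. *)
Definition kerb x : bool :=
  if excluded_middle_informative (kermu form x) then true else false.

Lemma kerbP x : reflect (kermu form x) (kerb x).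
Proof. by rewrite /kerb; case: excluded_middle_informative => h; constructor. Qed.

Definition x0 : H := epsilon (inhabits 0) nk.

Lemma nk_x0 : nk x0.
Proof.
apply: epsilon_spec; have [x [y xy]] := form_nz; exists x.
by apply: (@nkl _ y); rewrite cf_eq0.
Qed.

(* The additive extension of [phi z] from the complement of [ker mu] to [H]. *)
Definition psi z h := if kerb h then phi z (x0 + h) - phi z x0 else phi z h.

Lemma psi_nk z h : nk h -> psi z h = phi z h.
Proof. by rewrite /psi; case: kerbP. Qed.

(** * Degrees in [ker mu]: the additive map [psi z] *)

Section KernelDegree.
Variables (z : H) (hz : kermu form z).

(** The pairings with [z] vanish in the boundary relation, and [cf x y] factors out of what
    remains. *)
Lemma phi_addP x y : cf x y != 0 -> B (phi z (x + y) - phi z x - phi z y).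
Proof.
move=> xy; have hu : nk (z - x - y).
  by apply: (@nkr x); rewrite !cfE kermu_cfr //; apply: contra_neq xy => ?; lra.
apply: (inspanZK xy); apply: inspan_eq (phi_bd (nkl xy) (nkr xy) hu) _.
rewrite !(kermu_cfr _ hz); module_ring.
Qed.

(** When [cf x y] is 0, a common witness [w] allows [phi z (x + y + w)] to be split as [x + (y + w)]
    and as [(x + y) + w], with [phi_addP] applying each time. *)
Lemma phi_add x y : nk x -> nk y -> nk (x + y) ->
  B (phi z (x + y) - phi z x - phi z y).
Proof.
move=> hx hy hxy.
have [|w hw] := @common_witness [:: x; y; x + y].
  by move=> t; rewrite !inE => /or3P[]/eqP ->.
have [xw yw xyw] : [/\ cf x w != 0, cf y w != 0 & cf (x + y) w != 0].
  by split; apply: hw; rewrite !inE eqxx ?orbT.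
have [xy|xy] := eqVneq (cf x y) 0; last exact: phi_addP.
have xyw' : cf x (y + w) != 0 by rewrite cfDr xy add0r.
have e : x + (y + w) = x + y + w by exact: addrA.
apply: inspan_eq (inspanD (inspanB (phi_addP xyw') (phi_addP xyw)) (phi_addP yw)) _.
rewrite e; module_ring.
Qed.

(** Makes the extension to [ker mu] independent of the base point [x0]. If [x + y] is outside
    [ker mu], one splits [phi z (x + y + k)] with [k] attached to either summand. *)
Lemma phi_ker x y k : kermu form k -> nk x -> nk y ->
  B (phi z (x + k) - phi z x - (phi z (y + k) - phi z y)).
Proof.
move=> hk; have gen s t : nk s -> nk t -> nk (s + t) ->
    B (phi z (s + k) - phi z s - (phi z (t + k) - phi z t)).
  move=> hs ht hst.
  have e1 : s + k + t = s + t + k by exact: addrAC.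
  have e2 : s + (t + k) = s + t + k by exact: addrA.
  have n1 : nk (s + k + t) by rewrite e1; exact: nkD.
  have n2 : nk (s + (t + k)) by rewrite e2; exact: nkD.
  apply: inspan_eq (inspanB (phi_add hs (nkD ht hk) n2) (phi_add (nkD hs hk) ht n1)) _.
  rewrite e1 e2; module_ring.
move=> hx hy; case: (classic (kermu form (x + y))) => hxy; last exact: gen.
(* If [x + y] is in [ker mu], both are compared with a [w] pairing nontrivially with [x], hence with
   [y]. *)
have [w xw] := nkP hx.
have yx : cf y w = - cf x w.
  by apply/eqP; rewrite -addr_eq0 addrC -cfDl kermu_cfl.
have xxw : nk (x + w) by apply: (@nkr x); rewrite !cfE add0r.
have yw : cf y w != 0 by rewrite yx oppr_eq0.
have yyw : nk (y + w) by apply: (@nkr y); rewrite !cfE add0r.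
apply: inspan_eq (inspanB (gen _ _ hx (nkr xw) xxw) (gen _ _ hy (nkr xw) yyw)) _.
module_ring.
Qed.

Lemma psi_ker y k : kermu form k -> nk y -> B (psi z k - (phi z (y + k) - phi z y)).
Proof. by rewrite /psi; case: kerbP => // _ hk hy; apply: phi_ker => //; exact: nk_x0. Qed.

Lemma psi_add h h' : B (psi z (h + h') - psi z h - psi z h').
Proof.
have mixed k x : kermu form k -> nk x -> B (psi z (x + k) - psi z x - psi z k).
  move=> hk hx; rewrite (psi_nk _ (nkD hx hk)) (psi_nk _ hx).
  apply: inspan_eq (inspanN (psi_ker hk hx)) _; module_ring.
case: (classic (kermu form h)) => hh; case: (classic (kermu form h')) => hh'.
- have h1 := psi_ker (kermuD hh hh') nk_x0.
  have h2 := psi_ker hh nk_x0; have h3 := psi_ker hh' (nkD nk_x0 hh).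
  have e : x0 + (h + h') = x0 + h + h' by exact: addrA.
  rewrite e in h1; apply: inspan_eq (inspanB (inspanB h1 h2) h3) _; module_ring.
- have e : h + h' = h' + h by exact: addrC.
  apply: inspan_eq (mixed _ _ hh hh') _; rewrite e; module_ring.
- by apply: inspan_eq (mixed _ _ hh' hh) _.
case: (classic (kermu form (h + h'))) => hs; last first.
  by rewrite !psi_nk //; exact: phi_add.
(* The sum lies in [ker mu] but its terms do not: [psi] is evaluated at base point [y], and
   [y + (h + h')] is split as [h' + (h + y)], where both additions have a nonzero pairing. *)
have [y hy] := nkP hh.
have h'E t : cf h' t = - cf h t.
  by apply/eqP; rewrite -addr_eq0 addrC -cfDl kermu_cfl.
have h'y : cf h' (h + y) != 0 by rewrite h'E !cfE add0r oppr_eq0.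
have e : h' + (h + y) = y + (h + h') by rewrite addrA [h' + h]addrC addrC.
have h1 := phi_addP h'y; rewrite e in h1.
rewrite (psi_nk _ hh) (psi_nk _ hh').
apply: inspan_eq (inspanD (psi_ker hs (nkr hy)) (inspanD h1 (phi_addP hy))) _.
module_ring.
Qed.

Lemma psi0 : B (psi z 0).
Proof.
have h := psi_add 0 0; have e : 0 + 0 = 0 :> H by exact: addr0.
rewrite e in h.
apply: inspan_eq (inspanN h) _; module_ring.
Qed.

(** Antisymmetry gives [phi z (x0 + z) ~ - phi z (- x0)], and additivity turns the right side into
    [phi z x0]. *)
Lemma psiz : B (psi z z).
Proof.
have nN := nkN nk_x0; have h := psi_add x0 (- x0).
have e0 : x0 - x0 = 0 by exact: subrr.
rewrite e0 (psi_nk _ nk_x0) (psi_nk _ nN) in h.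
have hzx : nk (x0 + z) by apply: nkD => //; exact: nk_x0.
have h2 := wdU_anti nN hzx.
have e1 : wdU (- x0) (x0 + z) = phi z (- x0) by rewrite /phi opprK addrC.
have e2 : wdU (x0 + z) (- x0) = phi z (x0 + z) 
  by rewrite /phi; congr (wdU _ _); rewrite opprD addrCA subrr addr0.
rewrite e1 e2 in h2.
apply: inspan_eq (inspanD (inspanD (psi_ker hz nk_x0) h2) (inspanB h psi0)) _.
module_ring.
Qed.

Lemma psi_shift h n : B (psi z (h + z *~ n) - psi z h).
Proof.
suff hn : B (psi z (z *~ n)).
  apply: inspan_eq (inspanD (psi_add h (z *~ n)) hn) _; module_ring.
have nat_case (m : nat) : B (psi z (z *+ m)).
  elim: m => [|m IHm]; first exact: psi0.
  have e : z *+ m.+1 = z + z *+ m by exact: mulrS.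
  rewrite e; apply: inspan_eq (inspanD (psi_add z (z *+ m)) (inspanD psiz IHm)) _.
  module_ring.
case: n => m; first exact: nat_case.
(* [Negz m] denotes [-(m + 1)]; additivity reduces it to the multiple [m.+1]. *)
have h1 := psi_add (z *+ m.+1) (- (z *+ m.+1)).
have e : z *+ m.+1 - z *+ m.+1 = 0 by exact: subrr.
rewrite e in h1; have -> : z *~ Negz m = - (z *+ m.+1) by [].
apply: inspan_eq (inspanB psi0 (inspanD h1 (nat_case m.+1))) _.
module_ring.
Qed.

End KernelDegree.

(** * The first isomorphism *)

Local Notation C := (tensB form).

Definition tn z q h : TFree H := << (z, (q, h)) >>.

Lemma tn_add z q h h' : kermu form z -> C (tn z q (h + h') - tn z q h - tn z q h').
Proof.
by move=> hz; apply: inspan_gen; exists z, q, q, h, h'; split=> //; apply: Or42.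
Qed.

Lemma tn_scale z q q' h : kermu form z -> C (q' *: tn z q h - tn z (q' * q) h).
Proof.
by move=> hz; apply: inspan_gen; exists z, q, q', h, h; split=> //; apply: Or43.
Qed.

Lemma tn_z z q : kermu form z -> C (tn z q z).
Proof.
move=> hz; have h0 := tn_add q 0 0 hz.
have e : 0 + 0 = 0 :> H by exact: addr0.
rewrite e in h0.
have h1 : C (tn z q 0 - tn z q z).
  apply: inspan_gen; exists z, q, q, 0, z; split=> //; apply: Or44.
  by split=> //; exists 1; rewrite add0r.
apply: inspan_eq (inspanN (inspanD h0 h1)) _; module_ring.
Qed.

Definition tpair x y : TFree H := if kerb (x + y) then tn (x + y) 1 x else 0.
(** Words of length other than two take the default value 0, which makes the map total. *)
Definition tword (k : seq (QH H)) : TFree H :=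
  if k is [:: a; b] then bilin tpair a b else 0.
Definition tmap : FreeT (QH H) -> TFree H := mlin tword.

Lemma tmap_wd2 a b : tmap (wd2 a b) = bilin tpair a b.
Proof. exact: mlinU. Qed.

Lemma tmap_lin k u v : tmap (k *: u + v) = k *: tmap u + tmap v.
Proof. exact: linearP. Qed.

(** In degree [z = x + y] the sum is [1 (x) z], which vanishes in [H / Z z]. *)
Lemma tpair_sym x y : C (tpair x y + tpair y x).
Proof.
have e : y + x = x + y by exact: addrC.
rewrite /tpair e; case: kerbP => hz; last by rewrite addr0; exact: inspan0.
apply: inspan_eq (inspanB (tn_z 1 hz) (tn_add 1 x y hz)) _; module_ring.
Qed.

Lemma tmap_sym a b : C (bilin tpair a b + bilin tpair b a).
Proof.
apply: (@inspan_linear _ (fun=> True) _ _ (fun a => bilin tpair a b + bilin tpair b a)) => //.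
  by move=> k u v; rewrite bilinPl bilinPr; module_ring.
move=> x _; apply: (@inspan_linear _ (fun=> True) _ _
  (fun b => bilin tpair << x >> b + bilin tpair b << x >>)) => //.
  by move=> k u v; rewrite bilinPl bilinPr; module_ring.
by move=> y _; rewrite !bilinUU; exact: tpair_sym.
Qed.

(** If [z = x + y + u] is in [ker mu], then [cf x u = - cf x y] and [cf y u = cf x y]; the left side
    becomes [cf x y] times [1 (x) 2z], which vanishes. *)
Lemma tpair_bd x y u :
  C (cf x y *: tpair (x + y) u - cf x u *: tpair (x + u) y + cf y u *: tpair (y + u) x).
Proof.
have e1 : x + u + y = x + y + u by exact: addrAC.
have e2 : y + u + x = x + y + u by rewrite addrC addrA.
rewrite /tpair e1 e2; case: kerbP => hz; last first.
  by rewrite !scaler0 subr0 addr0; exact: inspan0.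
have exu : cf x u = - cf x y.
  by apply/eqP; rewrite -addr_eq0; have := kermu_cfr x hz; rewrite !cfE add0r addrC => ->.
have eyu : cf y u = cf x y.
  apply/eqP; rewrite -subr_eq0 -[- cf x y](cf_anti y x).
  by have := kermu_cfr y hz; rewrite !cfE addr0 addrC => ->.
set z := x + y + u in hz *.
have h1 := tn_add 1 x y hz; have h2 := tn_add 1 x u hz; have h3 := tn_add 1 y u hz.
have h4 := tn_add 1 (x + y) u hz; rewrite -/z in h4; have h5 := tn_z 1 hz.
have h := inspanD (inspanD (inspanD h2 h3) (inspanZ 2 (inspanB h5 h4))) (inspanN h1).
rewrite exu eyu.
apply: inspan_eq (inspanZ (cf x y) h) _; module_ring.
Qed.

Lemma tmap_bd a b c :
  C (bilin tpair (br a b) c - bilin tpair (br a c) b + bilin tpair (br b c) a).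
Proof.
pose G a b c := bilin tpair (br a b) c - bilin tpair (br a c) b + bilin tpair (br b c) a.
apply: (@inspan_linear _ (fun=> True) _ _ (fun a => G a b c)) => //.
  by move=> k u v; rewrite /G !br_linl !bilinPl bilinPr; module_ring.
move=> x _; apply: (@inspan_linear _ (fun=> True) _ _ (fun b => G << x >> b c)) => //.
  by move=> k u v; rewrite /G br_linl br_linr !bilinPl bilinPr; module_ring.
move=> y _; apply: (@inspan_linear _ (fun=> True) _ _ (fun c => G << x >> << y >> c)) => //.
  by move=> k u v; rewrite /G !br_linr !bilinPl bilinPr; module_ring.
by move=> u _; rewrite /G !brU !bilinZl !bilinUU; exact: tpair_bd.
Qed.

Lemma tmap_ceB (S : QH H -> Prop) c : ceB br S 2 c -> C (tmap c).
Proof.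
apply: inspan_map => {}c [[]|].
- move=> [l [r [k [x [y [[/size_cat_cons2 hs _] _ ->]]]]]].
  apply: inspan_eq (inspan0 _) _; apply: mlinUBZB.
  by case: hs => [[-> [b ->]]|[-> [a ->]]]; [exact: bilinPl | exact: bilinPr].
(* For a repeated letter, antisymmetry kills twice the image, and 2 is invertible in [rat]. *)
- move=> [k [/word2P[a [b [-> _ _]]] + ->]]; rewrite /= inE andbT negbK => /eqP ->.
  apply: (@inspanZK _ _ 2) => //; apply: inspan_eq (tmap_sym b b) _.
  rewrite mlinU -[tword _]/(bilin tpair b b); module_ring.
- move=> [k [/word3P[a [b [d [-> _ _ _]]]] ->]]; rewrite ce_bdU ce_word3.
  apply: inspan_eq (inspanN (tmap_bd a b d)) _.
  apply: etrans (mlinUNDB _ _ _ _) _; rewrite /=; module_ring.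
Qed.

Lemma tmap_tensZ c : tensZ form (tmap c).
Proof.
apply: (@suppin_mlin _ (fun t : H * (rat * H) => kermu form t.1)) => k _.
case: k => [|a [|b [|? ?]]] /=; try exact: suppin0.
apply: suppin_mlin => x _; apply: suppin_mlin => y _.
by rewrite /tpair; case: kerbP => h; [apply: suppinU | apply: suppin0].
Qed.

(** * The inverse map and the decomposition of 2-chains *)

Definition back_gen (t : H * (rat * H)) : FreeT (QH H) :=
  if kerb t.1 then t.2.1 *: psi t.1 t.2.2 else 0.
Definition back : TFree H -> FreeT (QH H) := mlin back_gen.

Lemma back_tn z q h : kermu form z -> back (tn z q h) = q *: psi z h.
Proof. by move=> hz; rewrite /back /tn mlinU /back_gen /=; case: kerbP. Qed.

Lemma back_lin k u v : back (k *: u + v) = k *: back u + back v.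
Proof. exact: linearP. Qed.

(** The relations in the scalar hold exactly; the other two are [psi_add] and [psi_shift]. *)
Lemma back_tensB t : C t -> B (back t).
Proof.
apply: inspan_map => {}t [z [q [q' [h [h' [hz]]]]]].
have E r s : back_gen (z, (r, s)) = r *: psi z s by rewrite /back_gen /=; case: kerbP.
case=> [||| [[n ->]]] ->.
- apply: inspan_eq (inspan0 _) _.
  by apply: etrans (mlinUBB _ _ _ _) _; rewrite !E; module_ring.
- apply: inspan_eq (inspanZ q (psi_add hz h h')) _.
  by apply: etrans (mlinUBB _ _ _ _) _; rewrite !E; module_ring.
- apply: inspan_eq (inspan0 _) _.
  by apply: etrans (mlinUZB _ _ _ _) _; rewrite !E; module_ring.
- apply: inspan_eq (inspanZ (- q) (psi_shift hz h n)) _.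
  by apply: etrans (mlinUB _ _ _) _; rewrite !E; module_ring.
Qed.

(* [bracket_section] splits the bracket in the degrees outside [ker mu]. *)
Definition bracket_section w : FreeT (QH H) :=
  if kerb w then 0 else
  let y := epsilon (inhabits 0) (fun y => cf y w != 0) in (cf y w)^-1 *: phi w y.

Definition section_word (k : seq (QH H)) : FreeT (QH H) :=
  if k is [:: a] then mlin bracket_section a else 0.
Definition section_map : FreeT (QH H) -> FreeT (QH H) := mlin section_word.

Lemma section_lin k u v : section_map (k *: u + v) = k *: section_map u + section_map v.
Proof. exact: linearP. Qed.

(** An exact equality: [section_map] is linear in the letter of a word of length one, and such a
    word cannot repeat a letter. *)
Lemma section_rel (S : QH H -> Prop) c : wedge_rel S 1 c -> section_map c = 0.
Proof.
move: c; apply: inspan_ind; first exact: linear0.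
  by move=> k u v hu hv; rewrite section_lin hu hv scaler0 addr0.
move=> c [].
  move=> [l [r [k [x [y [[/size_cat_cons1[-> ->] _] _ ->]]]]]] /=.
  by apply: mlinUBZB; exact: linearP.
by move=> [[|? [|? ?]] [[]]].
Qed.

(** According to the degree [x + y], one correction term is 0: [bracket_section] inside [ker mu],
    [tpair] outside. *)
Lemma wdU_decomp x y : nk x -> nk y ->
  B (wdU x y - back (tpair x y) - cf x y *: bracket_section (x + y)).
Proof.
move=> hx hy.
have e : wdU x y = phi (x + y) x by rewrite /phi addrC addKr.
have exy : cf x y = cf x (x + y) by rewrite !cfE add0r.
rewrite /tpair /bracket_section; case: kerbP => hz.
  rewrite (back_tn 1 x hz) (psi_nk (x + y) hx) e.
  by apply: inspan_eq (inspan0 _) _; module_ring.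
have hxy : nk (x + y - x) by rewrite addrC addKr.
set v := epsilon _ _; have hv : cf v (x + y) != 0.
  apply: (epsilon_spec (inhabits 0) (fun y' => cf y' (x + y) != 0)).
  by have [t ht] := nkP hz; exists t; rewrite cf_anti oppr_eq0.
have e0 : back 0 = 0 by exact: linear0.
rewrite e exy e0 subr0.
exact: phi_section.
Qed.

(** Of the three terms only [wd2 a b] is not exactly bilinear, so the defect of the whole is a wedge
    relation. *)
Lemma wd2_decomp a b : g a -> g b ->
  B (wd2 a b - back (bilin tpair a b) - mlin bracket_section (br a b)).
Proof.
pose G a b := wd2 a b - back (bilin tpair a b) - mlin bracket_section (br a b).
have defect (k : rat) (t tu tv p pu pv s su sv : FreeT (QH H)) :
    p = k *: pu + pv -> s = k *: su + sv ->
    t - p - s - k *: (tu - pu - su) - (tv - pv - sv) = t - k *: tu - tv.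
  by move=> -> ->; module_ring.
move=> /derivedP ha gb; rewrite -/(G a b).
apply: (@inspan_linear_mod _ nk _ _ (fun a => G a b)) ha.
  move=> k u v /derivedP gu /derivedP gv.
  apply: inspan_eq (rel_ceB (wd2_linl k gu gv gb)) _; apply: defect.
    by rewrite bilinPl back_lin.
  by rewrite br_linl; exact: linearP.
move=> x /gU gx; move: gb => /derivedP; apply: (@inspan_linear_mod _ nk _ _ (G << x >>)).
  move=> k u v /derivedP gu /derivedP gv.
  apply: inspan_eq (rel_ceB (wd2_linr k gx gu gv)) _; apply: defect.
    by rewrite bilinPr back_lin.
  by rewrite br_linr; exact: linearP.
move=> y /gU/derivedP gy; rewrite /G bilinUU brU linearZ /= mlinU.
(* Reading the support of a basis vector recovers that its index is outside [ker mu]. *)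
move: gx gy => /derivedP gx gy; apply: wdU_decomp.
  by apply: gx; rewrite msuppU /= inE.
by apply: gy; rewrite msuppU /= inE.
Qed.

(** The boundary of a 2-word is minus its bracket, hence the plus sign. On cycles the section term
    vanishes, so [back] inverts [tmap] modulo boundaries. *)
Lemma chain_decomp c : chains g 2 c ->
  B (c - back (tmap c) + section_map (ce_bd br c)).
Proof.
move: c; apply: (@inspan_linear _ (word g 2) _ _
  (fun c => c - back (tmap c) + section_map (ce_bd br c))).
  move=> k u v; rewrite tmap_lin back_lin.
  rewrite ce_bd_lin section_lin.
  module_ring.
move=> k /word2P[a [b [-> ga gb]]]; rewrite ce_bdU ce_word2 -/(wd2 a b) tmap_wd2.
have -> : section_map (- wd1 (br a b)) = - mlin bracket_section (br a b).
  by rewrite /section_map linearN /= mlinU.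
exact: wd2_decomp.
Qed.

Lemma tmap_inj c : ceZ br g 2 c -> C (tmap c) -> B c.
Proof.
move=> [hc hbd] ht; have := chain_decomp hc; rewrite (section_rel hbd) addr0 => h.
by apply: inspan_eq (inspanD h (back_tensB ht)) _; rewrite subrK.
Qed.

Lemma tmap_phi z x : kermu form z -> tmap (phi z x) = tn z 1 x.
Proof.
move=> hz; rewrite /phi /wdU tmap_wd2 bilinUU /tpair addrC subrK.
by case: kerbP.
Qed.

Lemma phi_cycle z x : kermu form z -> nk x -> ceZ br g 2 (phi z x).
Proof.
move=> hz hx; have hzx : nk (z - x) by rewrite addrC; apply: nkD => //; exact: nkN.
split.
  by apply: (@suppinU _ (word g 2)); apply: word2; exact: gU.
rewrite /phi /wdU /wd2 ce_bdU ce_word2 brU !cfE (kermu_cfr _ hz) subr0 scale0r.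
by apply: inspanN; apply: wd1_0; exact: g0.
Qed.

Lemma ceZ_lin (S : QH H -> Prop) k u v :
  ceZ br S 2 u -> ceZ br S 2 v -> ceZ br S 2 (k *: u + v).
Proof.
move=> [hu bu] [hv bv]; split; first exact: (@suppinP _ (word S 2)).
rewrite ce_bd_lin.
by apply: inspanD => //; exact: inspanZ.
Qed.

Lemma ceZ0 (S : QH H -> Prop) : ceZ br S 2 0.
Proof.
split; first exact: (@suppin0 _ (word S 2)).
by rewrite ce_bd0; exact: inspan0.
Qed.

Lemma psi_cycle z h : kermu form z -> ceZ br g 2 (psi z h).
Proof.
move=> hz; rewrite /psi; case: kerbP => hh; last exact: phi_cycle.
have h1 : ceZ br g 2 (phi z (x0 + h)) by apply: phi_cycle => //; apply: nkD => //; exact: nk_x0.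
have h2 : ceZ br g 2 (phi z x0) by apply: phi_cycle => //; exact: nk_x0.
by rewrite addrC -scaleN1r; exact: ceZ_lin.
Qed.

Lemma back_cycle t : tensZ form t -> ceZ br g 2 (back t).
Proof.
move=> ht; rewrite /back /mlin big_seq; apply: (big_ind (ceZ br g 2)).
- exact: ceZ0.
- by move=> u v hu hv; rewrite -[u]scale1r; exact: ceZ_lin.
move=> k /ht hk; rewrite -[_ *: _]addr0; apply: ceZ_lin; last exact: ceZ0.
rewrite /back_gen; case: kerbP => // _; rewrite -[_ *: _]addr0.
by apply: ceZ_lin; [exact: psi_cycle | exact: ceZ0].
Qed.

Lemma tmap_psi z h : kermu form z -> C (tmap (psi z h) - tn z 1 h).
Proof.
move=> hz; rewrite /psi; case: kerbP => hh; last first.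
  by rewrite tmap_phi // subrr; exact: inspan0.
have -> : tmap (phi z (x0 + h) - phi z x0) = tn z 1 (x0 + h) - tn z 1 x0.
  have L u v : tmap (u - v) = tmap u - tmap v by exact: linearB.
  by rewrite L; congr (_ - _); exact: tmap_phi.
exact: tn_add.
Qed.

Lemma tmap_back t : tensZ form t -> C (tmap (back t) - t).
Proof.
move: t; apply: (@inspan_linear _ (fun t : H * (rat * H) => kermu form t.1) _ _
  (fun t => tmap (back t) - t)).
  by move=> k u v; rewrite back_lin tmap_lin; module_ring.
move=> [z [q h]] /= hz; rewrite -/(tn z q h) back_tn //.
have -> : tmap (q *: psi z h) = q *: tmap (psi z h) by exact: linearZ.
have hs := tn_scale 1 q h hz; rewrite mulr1 in hs.
apply: inspan_eq (inspanD (inspanZ q (tmap_psi h hz)) hs) _; module_ring.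
Qed.

Lemma H2_derived :
  sq_iso (ceZ br g 2) B (tensZ form) C.
Proof.
exists tmap; split.
- by move=> k x y _ _; exact: tmap_lin.
- by move=> c _; exact: tmap_tensZ.
- exact: tmap_ceB.
- exact: tmap_inj.
- by move=> t ht; exists (back t); [exact: back_cycle | exact: tmap_back].
Qed.

(** * The second isomorphism *)

Definition proj (P : pred H) : QH H -> QH H := mlin (fun x => if P x then << x >> else 0).
HB.instance Definition _ P :=
  GRing.isLinear.Build rat (QH H) (QH H) *:%R (proj P) (mlin_is_linear _).

Lemma proj_supp (P : pred H) a : suppin (fun x => P x) (proj P a).
Proof.
by apply: suppin_mlin => x _; case: ifP => h; [exact: suppinU | exact: suppin0].
Qed.

Lemma proj_fix (P : pred H) a : suppin (fun x => P x) a -> proj P a = a.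
Proof. by move=> h; rewrite -[RHS]mlin_id; apply: eq_mlin => x /h ->. Qed.

Lemma proj_kill (P : pred H) a : suppin (fun x => ~~ P x) a -> proj P a = 0.
Proof. by move=> h; rewrite -[RHS](mlin0 _ a); apply: eq_mlin => x /h /negbTE ->. Qed.

Lemma proj_split P a : proj P a + proj (predC P) a = a.
Proof.
rewrite -[RHS]mlin_id /proj /mlin -big_split; apply: eq_bigr => x _ /=.
by case: (P x); rewrite /= scaler0 ?addr0 ?add0r.
Qed.

Definition pk := proj kerb.
Definition pn := proj (predC kerb).
HB.instance Definition _ := GRing.Linear.on pk.
HB.instance Definition _ := GRing.Linear.on pn.

Local Notation kerQ := (Qspan (kermu form)).
Local Notation A := (ceB br (@QHall H) 2).

Lemma kerQP a : kerQ a <-> suppin (fun x => kerb x) a.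
Proof. by split=> h x /h /kerbP. Qed.

Lemma gP a : g a <-> suppin (fun x => ~~ kerb x) a.
Proof. by rewrite derivedP; split=> h x /h /= /kerbP. Qed.

Lemma kerQ0 : kerQ 0.
Proof. exact: (@suppin0 _ (kermu form)). Qed.
Arguments kerQ0 : clear implicits.

Lemma kerQ_pk a : kerQ (pk a).
Proof. by apply/kerQP; exact: proj_supp. Qed.
Arguments kerQ_pk : clear implicits.

Lemma g_pn a : g (pn a).
Proof. by apply/gP; exact: proj_supp. Qed.

Lemma pk_fix a : kerQ a -> pk a = a.
Proof. by move=> /kerQP; exact: proj_fix. Qed.

Lemma pn_fix a : g a -> pn a = a.
Proof. by move=> /gP; exact: proj_fix. Qed.

Lemma pk_kill a : g a -> pk a = 0.
Proof. by move=> /gP; exact: proj_kill. Qed.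

Lemma pn_kill a : kerQ a -> pn a = 0.
Proof. by move=> /kerQP h; apply: proj_kill => x /h /=; rewrite negbK. Qed.

Lemma br_kerl a b : kerQ a -> br a b = 0.
Proof.
move=> ha; rewrite brE -[RHS](mlin0 _ a); apply: eq_mlin => x /ha hx.
by rewrite -[RHS](mlin0 _ b); apply: eq_mlin => y _; rewrite kermu_cfl // scale0r.
Qed.

Lemma br_kerr a b : kerQ b -> br a b = 0.
Proof.
move=> hb; rewrite brE -[RHS](mlin0 _ a); apply: eq_mlin => x _.
by rewrite -[RHS](mlin0 _ b); apply: eq_mlin => y /hb hy; rewrite kermu_cfr // scale0r.
Qed.

Lemma split1 a : a = 1 *: pk a + pn a.
Proof. by rewrite scale1r; apply/esym; exact: proj_split. Qed.

(** The components in [Q[ker mu]] are central and drop out of brackets. *)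
Lemma br_pn a b : br (pn a) (pn b) = br a b.
Proof.
rewrite [in RHS](split1 a) [in RHS](split1 b) br_linl.
rewrite (br_kerl _ (kerQ_pk a)) br_linr (br_kerr _ (kerQ_pk b)).
by rewrite !scaler0 !add0r.
Qed.

Lemma g_br a b : g (br a b).
Proof. by apply/derivedP; exact: br_nk. Qed.

Lemma pn_br a b : pn (br a b) = br (pn a) (pn b).
Proof. by rewrite br_pn pn_fix //; exact: g_br. Qed.

Lemma pk_br a b : pk (br a b) = 0.
Proof. exact/pk_kill/g_br. Qed.

(** [pn] respects brackets, so it commutes with the boundary. *)
Lemma ce_bd_wmap_pn c : chains (@QHall H) 2 c ->
  ce_bd br (wmap pn c) = wmap pn (ce_bd br c).
Proof.
move=> hc; rewrite /wmap -[ce_bd br]/(mlin (ce_word br)) !mlin_comp.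
apply: eq_mlin => k /hc /word2P[a [b [-> _ _]]].
rewrite mlinU /= !ce_word2 -pn_br linearN /=; congr (- _).
by rewrite mlinU.
Qed.

(** [pk] kills brackets, so the boundary of a 3-word maps to words with a letter 0. The image thus
    satisfies the wedge relations alone, as fits an abelian target. *)
Lemma wmap_pk_ceB c : A c -> wedge_rel kerQ 2 (wmap pk c).
Proof.
apply: inspan_map => u [hu|[k [/word3P[a [b [d [-> _ _ _]]]] ->]]].
  by apply/inspan_gen/(wedge_rel_gen_wmap (S := @QHall H)) => // x _; exact: kerQ_pk.
rewrite ce_bdU ce_word3; have h t := wd2_0l kerQ0 (kerQ_pk t).
apply: inspan_eq (inspanB (inspanD (inspanN (h d)) (h b)) (h a)) _.
by apply: etrans (mlinUNDB _ _ _ _) _; rewrite /= !pk_br.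
Qed.

Lemma wmap_pn_ceB c : A c -> B (wmap pn c).
Proof.
apply: inspan_map => u [hu|[k [/word3P[a [b [d [-> _ _ _]]]] ->]]]; apply: inspan_gen.
  by left; apply: (wedge_rel_gen_wmap (S := @QHall H)) hu => x _; exact: g_pn.
right; exists [:: pn a; pn b; pn d]; split; first by apply: word3; exact: g_pn.
apply: etrans (congr1 (wmap pn) (ce_bd3 _ _ _ _)) _.
apply: etrans (mlinUNDB _ _ _ _) (etrans _ (esym (ce_bd3 _ _ _ _))).
by rewrite /= !pn_br.
Qed.

(* [Q[ker mu]] is central and [g] is spanned by brackets, so mixed words bound. *)
Lemma mixed_ceB a b : kerQ a -> g b -> A (wd2 b a).
Proof.
move=> ha; move: b; apply: inspan_ind.
- by apply/rel_ceB/wd2_0l.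
- move=> k u v hu hv.
  have h := rel_ceB (wd2_linl k (S := @QHall H) (x := u) (y := v) (b := a) I I I).
  exact: inspan_defect h hu hv.
(* In the boundary of the word on [u], [v], [a], the two brackets with [a] are 0, leaving the word
   on the bracket of [u] and [v] followed by [a]. *)
move=> _ [u [v ->]]; have h := bd_ceB (S := @QHall H) (a := u) (b := v) (c := a) I I I.
rewrite (br_kerr u ha) (br_kerr v ha) in h.
have z0 t : A (wd2 0 t) by apply/rel_ceB/wd2_0l.
have drop (r s t : FreeT (QH H)) : A (r - s + t) -> A s -> A t -> A r.
  by move=> hr hs ht; apply: inspan_eq (inspanD hr (inspanB hs ht)) _; module_ring.
exact: drop h (z0 v) (z0 u).
Qed.

Lemma wd2_split a b : A (wd2 a b - (wd2 (pk a) (pk b) + wd2 (pn a) (pn b))).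
Proof.
have hl := rel_ceB (wd2_linl 1 (S := @QHall H) (x := pk a) (y := pn a) (b := b) I I I).
have hr t := rel_ceB (wd2_linr 1 (S := @QHall H) (a := t) (x := pk b) (y := pn b) I I I).
rewrite -split1 in hl.
have {}hr t : A (wd2 t b - 1 *: wd2 t (pk b) - wd2 t (pn b)).
  by have := hr t; rewrite -split1.
have m1 := mixed_ceB (kerQ_pk b) (g_pn a).
have m2 := mixed_ceB (kerQ_pk a) (g_pn b).
have m3 : A (wd2 (pk a) (pn b) + wd2 (pn b) (pk a)) by apply/rel_ceB/wd2_anti.
have h := inspanD (inspanD hl (hr (pk a)))
  (inspanD (hr (pn a)) (inspanD m1 (inspanB m3 m2))).
apply: inspan_eq h _; module_ring.
Qed.

Lemma chain_split c : chains (@QHall H) 2 c -> A (c - (wmap pk c + wmap pn c)).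
Proof.
move: c; apply: (@inspan_linear _ (word (@QHall H) 2) _ _
  (fun c => c - (wmap pk c + wmap pn c))).
  by move=> k u v; rewrite !wmap_lin; module_ring.
move=> k /word2P[a [b [-> _ _]]]; rewrite -/(wd2 a b) !wmap_wd2.
exact: wd2_split.
Qed.

(** The two projections of letters give the map; its inverse is the sum of chains. *)
Lemma H2_full :
  sq_iso (ceZ br (@QHall H) 2) A (dsumZ (chains kerQ 2) (ceZ br g 2))
    (dsumZ (wedge_rel kerQ 2) B).
Proof.
have gS t : g t -> QHall t by [].
have kS t : kerQ t -> QHall t by [].
exists (fun c => (wmap pk c, wmap pn c)); split.
- by move=> k u v _ _; rewrite !wmap_lin.
- move=> c [hc hbd]; split=> /=.
    by apply: chains_wmap hc => x _; exact: kerQ_pk.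
  split; first by apply: chains_wmap hc => x _; exact: g_pn.
  rewrite ce_bd_wmap_pn //.
  by apply: wedge_rel_wmap hbd => x _; exact: g_pn.
- by move=> c hc; split; [exact: wmap_pk_ceB | exact: wmap_pn_ceB].
(* Both projections become boundaries in the full algebra, and [chain_split] says that their sum
   represents [c]. *)
- move=> c [hc _] [/= /(wedge_rel_mono kS)/rel_ceB hk /(ceB_mono gS) hg].
  by apply: inspan_eq (inspanD (chain_split hc) (inspanD hk hg)) _; rewrite subrK.
(* The preimage is [u + v]; [u] is a cycle because its letters are central. *)
move=> [u v] [/= hu hv]; have [hvc hvb] := hv; exists (1 *: u + v).
  apply: ceZ_lin; last first.
    by split; [exact: chains_mono hvc | exact: wedge_rel_mono hvb].
  split; first exact: chains_mono hu.
  move: u hu; apply: (@inspan_linear _ (word kerQ 2) _ _ (ce_bd br)).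
    exact: ce_bd_lin.
  move=> k /word2P[a [b [-> ha hb]]]; rewrite ce_bdU ce_word2 (br_kerl _ ha).
  by apply: inspanN; apply: wd1_0.
rewrite !wmap_lin !scale1r; split=> /=.
  have -> : wmap pk u = u.
    rewrite -[RHS]mlin_id; apply: eq_mlin => k /hu /word2P[a [b [-> ha hb]]].
    by rewrite /= !pk_fix.
  rewrite [u + _]addrC addrK; move: v hvc {hv hvb}.
  apply: (@inspan_linear _ (word g 2) _ _ (wmap pk)); first exact: wmap_lin.
  (* The image is the formal word with two letters 0, a relation because its letter repeats. *)
  move=> k /word2P[a [b [-> ha hb]]]; rewrite wmap_wd2 /= (pk_kill ha) (pk_kill hb).
  by apply: wd2_diag; exact: kerQ0.
have -> : wmap pn v = v.
  rewrite -[RHS]mlin_id; apply: eq_mlin => k /hvc /word2P[a [b [-> ha hb]]].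
  by rewrite /= !pn_fix.
rewrite addrK; move: u hu.
apply: (@inspan_linear _ (word kerQ 2) _ _ (wmap pn)); first exact: wmap_lin.
move=> k /word2P[a [b [-> ha hb]]]; rewrite wmap_wd2 /= (pn_kill ha) (pn_kill hb).
by apply/rel_ceB/wd2_diag; exact: g0.
Qed.

End Goldman.

Theorem theorem1p1 (H : zmodType) (form : H -> H -> int)
  (form_addl : forall x y z, form (x + y) z = form x z + form y z)
  (form_addr : forall x y z, form x (y + z) = form x y + form x z)
  (form_alt : forall x, form x x = 0)
  (form_nz : exists x y, form x y != 0) :
  (* H_2(Q[H]^(1)) ~= bigoplus_{z in ker mu} Q (x)_Z (H/Zz) *)
  sq_iso (ceZ (gbracket form) (derived form) 2) (ceB (gbracket form) (derived form) 2)
         (tensZ form) (tensB form)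
  /\
  (* H_2(Q[H]) ~= wedge^2 Q[ker mu]  (+)  H_2(Q[H]^(1)) *)
  sq_iso (ceZ (gbracket form) (@QHall H) 2) (ceB (gbracket form) (@QHall H) 2)
         (dsumZ (chains (Qspan (kermu form)) 2)
                (ceZ (gbracket form) (derived form) 2))
         (dsumZ (wedge_rel (Qspan (kermu form)) 2)
                (ceB (gbracket form) (derived form) 2)).
Proof.
split; first exact: (H2_derived form_addl form_addr form_alt form_nz).
exact: (H2_full form_addl form_addr form_alt).
Qed.
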